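(* Let $f$ be the fractal interpolation function (FIF), built with free parameters $\gamma_k$ and functions $q_k$ ($k=1,\dots,N$), for interpolation data $\{(x_i,y_i)\in\mathbb{R}^2 : i=0,1,\ldots,N\}$, where $0=x_0<x_1<\cdots<x_N=1$, $x_k-x_{k-1}=\frac1N$ for $k=1,\ldots,N$, and $y_0=y_N=0$. Extend $f$ to $\mathbb{R}$ by setting $f(x)=0$ for $x\notin I=[x_0,x_N]=[0,1]$. Then the Fourier transform of $f$ is given, for $\omega\in\mathbb{R}$, by $$\hat f(\omega)=\sum_{j=1}^{\infty}\frac{1}{N^j}\sum_{k_1,k_2,\ldots,k_j=1}^{N}\gamma_{k_1}\gamma_{k_2}\cdots\gamma_{k_{j-1}}\,e^{-i\omega p_{k_1,k_2,\ldots,k_j}}\int_I q_{k_j}(x)\,e^{-i\omega x/N^{j}}\,dx,$$ where $p_{k_1,k_2,\ldots,k_j}=\frac{k_1-1}{N}+\frac{k_2-1}{N^2}+\cdots+\frac{k_j-1}{N^j}$.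
   Context: Fractal interpolation function. Let $I=[0,1]$, $x_k=k/N$, $I_k=[x_{k-1},x_k]$. For $k=1,\dots,N$ let $L_k:I\to I_k$, $L_k(x)=\frac{x+k-1}{N}$, and $F_k:I\times\mathbb{R}\to\mathbb{R}$, $F_k(x,y)=\gamma_k y+q_k(x)$, where the free parameters $\gamma_k$ are real with $|\gamma_k|<1$ and $q_k:I\to\mathbb{R}$ are continuous functions chosen such that $|F_k(x,y)-F_k(\bar x,\bar y)|\le s\,d_M((x,y),(\bar x,\bar y))$ for some $s<1$ and some metric $d_M$ equivalent to the Euclidean metric on $\mathbb{R}^2$, and $F_k(x_0,y_0)=y_{k-1}$, $F_k(x_N,y_N)=y_k$ (with $y_0=y_N=0$ this says $q_k(0)=y_{k-1}$ and $q_k(1)=y_k$). Put $\omega_k(x,y)=(L_k(x),F_k(x,y))$. The FIF for the data is the continuous function $f:I\to\mathbb{R}$ whose graph is the attractor of the iterated function system $\{I\times\mathbb{R};\omega_k,\ k=1,\dots,N\}$; it satisfies $f(x_i)=y_i$ for all $i$ and the functional equation $f(x)=\gamma_k f(L_k^{-1}(x))+q_k(L_k^{-1}(x))$ for $x\in I_k$, $k=1,\dots,N$. Fourier transform: $\hat f(\omega)=\int_{\mathbb{R}} f(x)e^{-i\omega x}\,dx$. An empty product equals $1$ and an empty sum equals $0$. *)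

(* Defs.v *)
From HB Require Import structures.
From mathcomp Require Import all_boot all_order all_algebra.
From mathcomp Require Import all_classical all_reals all_analysis.
From mathcomp Require Export complex.

Set Implicit Arguments.
Unset Strict Implicit.
Unset Printing Implicit Defensive.

Import Order.TTheory GRing.Theory Num.Theory.
Import numFieldNormedType.Exports.

Local Open Scope classical_set_scope.
Local Open Scope ring_scope.
Local Open Scope complex_scope.

Section Metric.
Context {R : realType} {T : Type}.
Implicit Type d : T -> T -> R.

Definition is_metric d : Prop :=
  [/\ forall p q, 0 <= d p q,
      forall p q, d p q = 0 <-> p = q,
      forall p q, d p q = d q p
    & forall p q r, d p r <= d p q + d q r].

Definition metric_open d (A : set T) : Prop :=
  forall p, A p -> exists2 r, 0 < r & forall q, d p q < r -> A q.

(* Topological equivalence: the weakest usual notion, hence implied by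
   Lipschitz equivalence. *)
Definition equivalent_metrics d d' : Prop :=
  forall A, metric_open d A <-> metric_open d' A.

End Metric.

Definition euclidean_dist {R : realType} (p q : R * R) : R :=
  Num.sqrt ((p.1 - q.1) ^+ 2 + (p.2 - q.2) ^+ 2).

Section IFS.
Context {T : topologicalType} {J : Type}.

Definition ifs_invariant (X : set T) (w : J -> T -> T) (A : set T) : Prop :=
  [/\ A `<=` X, A !=set0, compact A & A = \bigcup_k (w k @` A)].

(* Uniqueness is part of the notion: the interpolation system below has an
   attractor only for N > 1, its base map being the identity when N = 1. *)
Definition is_attractor (X : set T) (w : J -> T -> T) (A : set T) : Prop :=
  ifs_invariant X w A /\ forall B, ifs_invariant X w B -> B = A.

End IFS.

(* Data indexed by k = 1, ..., N in the mathematics is indexed here by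
   k : 'I_N = {0, ..., N-1}: [gamma k], [q k], [base_map k], [fiber_map _ _ k]
   stand for gamma_{k+1}, q_{k+1}, L_{k+1}, F_{k+1}. *)
Section FIF.
Context {R : realType} {N : nat}.
Implicit Types (x y : 'I_N.+1 -> R) (gamma : 'I_N -> R) (q : 'I_N -> R -> R).

(* Left and right ends of the k-th subinterval, as indices of nodes. *)
Definition lnode (k : 'I_N) : 'I_N.+1 := widen_ord (leqnSn N) k.
Definition rnode (k : 'I_N) : 'I_N.+1 := lift ord0 k.

Definition equispaced_nodes x : Prop :=
  [/\ x ord0 = 0, x ord_max = 1,
      forall k, x (lnode k) < x (rnode k)
    & forall k, x (rnode k) - x (lnode k) = N%:R^-1].

Definition base_map (k : 'I_N) (t : R) : R := (t + k%:R) / N%:R.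

Definition fiber_map gamma q (k : 'I_N) (p : R * R) : R := gamma k * p.2 + q k p.1.

Definition ifs_map gamma q (k : 'I_N) (p : R * R) : R * R :=
  (base_map k p.1, fiber_map gamma q k p).

Definition strip : set (R * R) := `[0, 1] `*` setT.

Definition admissible x y gamma q : Prop :=
  [/\ forall k, `|gamma k| < 1,
      forall k, {within `[0, 1], continuous (q k)},
      exists s, exists d : R * R -> R * R -> R,
        [/\ s < 1, is_metric d, equivalent_metrics d euclidean_dist
          & forall k p p', strip p -> strip p' ->
              `|fiber_map gamma q k p - fiber_map gamma q k p'| <= s * d p p']
    & forall k, fiber_map gamma q k (x ord0, y ord0) = y (lnode k) /\
                fiber_map gamma q k (x ord_max, y ord_max) = y (rnode k)].

(* Only the values of [f] on [0, 1] matter. *)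
Definition is_fif x y gamma q (f : R -> R) : Prop :=
  [/\ admissible x y gamma q,
      {within `[0, 1], continuous f}
    & is_attractor strip (ifs_map gamma q) [set (t, f t) | t in `[0, 1]]].

End FIF.

Section Fourier.
Context {R : realType}.
Local Notation mu := (@lebesgue_measure R).

Definition extend0 (f : R -> R) (t : R) : R := if 0 <= t <= 1 then f t else 0.

(* e^{it} *)
Definition expi (t : R) : R[i] := cos t +i* sin t.

Definition cintegral (D : set R) (g : R -> R[i]) : R[i] :=
  (\int[mu]_(t in D) complex.Re (g t)) +i* (\int[mu]_(t in D) complex.Im (g t)).

Definition fourier (f : R -> R) (w : R) : R[i] :=
  cintegral setT (fun t => (f t)%:C * expi (- (w * t))).

End Fourier.

Section FourierSeries.
Context {R : realType} {N : nat}.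

(* With 0-based digits, k_{l+1} - 1 is [k l]. *)
Definition base_point (j : nat) (k : {ffun 'I_j -> 'I_N}) : R :=
  \sum_(l < j) (k l)%:R / N%:R ^+ l.+1.

(* The summand of rank j+1: the word k_1, ..., k_{j+1} is [k], its last letter
   is [k ord_max], and the product runs over its first j letters. *)
Definition fif_fourier_term (gamma : 'I_N -> R) (q : 'I_N -> R -> R)
    (w : R) (j : nat) : R[i] :=
  ((N%:R ^+ j.+1)^-1)%:C *
  \sum_(k : {ffun 'I_j.+1 -> 'I_N})
    (\prod_(l < j.+1 | (l < j)%N) gamma (k l))%:C
    * expi (- (w * base_point k))
    * cintegral `[0, 1]
        (fun t => (q (k ord_max) t)%:C * expi (- (w * t / N%:R ^+ j.+1))).

End FourierSeries.

(* Main.v *)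
Require Import Defs.
From HB Require Import structures.
From mathcomp Require Import all_boot all_order all_algebra.
From mathcomp Require Import all_classical all_reals all_analysis.
From mathcomp Require Import ring.

Set Implicit Arguments.
Unset Strict Implicit.
Unset Printing Implicit Defensive.

Import Order.TTheory GRing.Theory Num.Theory.
Import numFieldNormedType.Exports.

Local Open Scope classical_set_scope.
Local Open Scope ring_scope.

(** Write U g (w) for the integral of g(t) e^{-iwt} over [0, 1], so that the
    Fourier transform in question is U f. The graph of f is mapped into itself
    by every map of the iterated function system, which says
      f (L_k t) = gamma_k f(t) + q_k(t)   for t in [0, 1].
    Cutting [0, 1] into the N intervals L_k([0, 1]) and substituting x = L_k t
    in each of them turns this into a functional equation for U f
    ([unit_fourier_fif]):
      U f (w) = 1/N sum_k e^{-iwk/N} (gamma_k U f (w/N) + U q_k (w/N)),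
    with digits k = 0, ..., N-1. The partial sums S_n of the series satisfy the
    matching recursion ([fif_fourier_partial_sumS])
      S_{n+1}(w) = 1/N sum_k e^{-iwk/N} (gamma_k S_n(w/N) + U q_k (w/N)),
    obtained by singling out the first letter of each word. The contributions
    of the q_k cancel in the difference:
      (U f - S_{n+1})(w) = 1/N sum_k e^{-iwk/N} gamma_k (U f - S_n)(w/N).
    Hence, with g = max_k |gamma_k| < 1, each step multiplies the supremum over
    all frequencies of |U f - S_n| by at most g ([fif_fourier_remainder]). As f
    is bounded on [0, 1], U f is bounded ([norm_unit_fourier_bounded]), and the
    remainder is O(g^n).

    Working with all frequencies at once is what makes the induction go
    through: it trades the frequency w for w/N. *)

(** * Integrals of continuous functions over segments *)

Section Integral.
Context {R : realType}.
Implicit Types (f g : R -> R) (a b c r w t : R).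
Local Notation mu := (@lebesgue_measure R).
Local Notation I := (`[0, 1]%classic : set R).

Lemma integrable_within_itv a b g :
  {within `[a, b], continuous g} -> mu.-integrable `[a, b] (EFin \o g).
Proof.
by move=> cg; apply: continuous_compact_integrable => //; exact: segment_compact.
Qed.

Lemma Rintegral_itv_split a b c g : a <= b -> b <= c ->
    {within `[a, c], continuous g} ->
  \int[mu]_(t in `[a, c]) g t =
  \int[mu]_(t in `[a, b]) g t + \int[mu]_(t in `[b, c]) g t.
Proof.
move=> ab bc cg; have ig := integrable_within_itv cg.
apply/eqP; rewrite addrC -subr_eq Rintegral_itvB ?bnd_simp//; apply/eqP.
apply: Rintegral_itv_obnd_cbnd; apply: integrableS ig => //.
by apply: subset_itvr; rewrite bnd_simp.
Qed.

Lemma within_continuous_comp (A B : set R) (phi g : R -> R) :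
  continuous phi -> (forall t, A t -> B (phi t)) ->
  {within B, continuous g} -> {within A, continuous (g \o phi)}.
Proof.
move=> cphi AB /subspace_continuousP cg; apply/subspace_continuousP => t At.
apply: cvg_comp (cg _ (AB _ At)).
move=> V /= [e e0 eV].
have [d d0 dV] := (@cvgrPdist_lt _ _ _ _ _ _ _).1 (cphi t) e e0.
by exists d => // s sd As; apply: eV; [exact: dV | exact: AB].
Qed.

Lemma Rintegral_affine a b c r g : a <= b -> 0 < r ->
    {within `[r * a + c, r * b + c], continuous g} ->
  \int[mu]_(t in `[r * a + c, r * b + c]) g t =
  r * \int[mu]_(t in `[a, b]) g (r * t + c).
Proof.
move=> ab r0 cg; pose F t : R := r * t + c.
have dF t : is_derive t 1 F r.
  have := is_deriveD (is_deriveZ r (is_derive_id t (1 : R))) (is_derive_cst c t (1 : R)).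
  by rewrite addr0 /GRing.scale/= mulr1.
have F'E : derive1 F = cst r by apply/funext => t; rewrite derive1E derive_val.
have cF : continuous F.
  by move=> t; apply/differentiable_continuous/derivable1_diffP; case: (dF t).
have cgF : {within `[a, b], continuous (g \o F)}.
  apply: within_continuous_comp cg => // t; rewrite /= !in_itv/= => /andP[a_t t_b].
  by rewrite /F !lerD2r !ler_pM2l// a_t t_b.
rewrite -RintegralZl//; last exact: integrable_within_itv.
rewrite /Rintegral (@integration_by_substitution_increasing _ F)//.
- by congr fine; apply: eq_integral => t _; rewrite F'E/= mulrC.
- by move=> s t _ _ st; rewrite /F ltrD2r ltr_pM2l.
- by rewrite F'E => t _; exact: cvg_cst.
- by rewrite F'E; exact: is_cvg_cst.
- by rewrite F'E; exact: is_cvg_cst.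
- split; first by move=> t _; case: (dF t).
  + by apply: cvg_at_right_filter; exact: cF.
  + by apply: cvg_at_left_filter; exact: cF.
Qed.

(** Self-similar form of the integral: the images of [0, 1] under the maps
    [base_map k] tile [0, 1], and each of these maps has slope 1/N. *)
Lemma Rintegral_unit_split (N : nat) g : (0 < N)%N ->
    {within I, continuous g} ->
  \int[mu]_(t in I) g t =
  N%:R^-1 * \sum_(k < N) \int[mu]_(t in I) g (base_map k t).
Proof.
move=> N0 cg; have NR0 : 0 < N%:R :> R by rewrite ltr0n.
have prefix n : (n <= N)%N ->
    \int[mu]_(t in `[0, n%:R / N%:R]) g t =
    \sum_(k < n) \int[mu]_(t in `[k%:R / N%:R, k.+1%:R / N%:R]) g t.
  elim: n => [|n IHn] nN; first by rewrite big_ord0 mul0r set_itv1 Rintegral_set1.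
  rewrite big_ord_recr/= -IHn ?(ltnW nN)//.
  apply: Rintegral_itv_split.
  - by rewrite divr_ge0.
  - by rewrite ler_pM2r ?invr_gt0// ler_nat.
  - apply: continuous_subspaceW cg; apply: subset_itvl.
    by rewrite bnd_simp ler_pdivrMr// mul1r ler_nat.
have := prefix N (leqnn N); rewrite divff ?gt_eqF// => ->.
rewrite mulr_sumr; apply: eq_bigr => k _.
have e0 : N%:R^-1 * 0 + k%:R / N%:R = k%:R / N%:R :> R by rewrite mulr0 add0r.
have e1 : N%:R^-1 * 1 + k%:R / N%:R = k.+1%:R / N%:R :> R.
  by rewrite mulr1 -natr1 mulrDl mul1r addrC.
have := @Rintegral_affine 0 1 (k%:R / N%:R) N%:R^-1 g ler01.
rewrite e0 e1 invr_gt0 => -> //.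
- by congr (_ * _); apply: eq_Rintegral => t _; rewrite /base_map mulrDl [_ * t]mulrC.
- apply: continuous_subspaceW cg; apply: subset_itv; rewrite bnd_simp ?divr_ge0//.
  by rewrite ler_pdivrMr// mul1r ler_nat.
Qed.
End Integral.

(** * The Fourier integral over the unit interval *)

Section ComplexIntegral.
Local Open Scope complex_scope.
Context {R : realType}.
Implicit Types (f g h : R -> R) (a b c r w t : R).
Local Notation mu := (@lebesgue_measure R).
Local Notation I := (`[0, 1]%classic : set R).

Lemma expiD a b : expi (a + b) = expi a * expi b.
Proof.
by rewrite /expi cosD sinD; simpc; congr (_ +i* _); rewrite addrC [X in X + _]mulrC.
Qed.

Lemma norm_expi a : `|expi a| = 1.
Proof. by rewrite normc_def/= cos2Dsin2 sqrtr1. Qed.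

Lemma mulC_expi a b : a%:C * expi b = (a * cos b) +i* (a * sin b).
Proof. by rewrite /expi; simpc. Qed.

Definition unit_fourier f w : R[i] :=
  cintegral I (fun t => (f t)%:C * expi (- (w * t))).

Lemma unit_fourierE f w : unit_fourier f w =
  (\int[mu]_(t in I) (f t * cos (- (w * t))))
  +i* (\int[mu]_(t in I) (f t * sin (- (w * t)))).
Proof.
by congr (_ +i* _); apply: eq_Rintegral => t _; rewrite mulC_expi.
Qed.

Lemma fourier_extend0 f w : fourier (extend0 f) w = unit_fourier f w.
Proof.
rewrite unit_fourierE; congr (_ +i* _); rewrite [RHS]Rintegral_mkcond;
  apply: eq_Rintegral => t _; rewrite mulC_expi/= /extend0 patchE;
  by rewrite mem_setE in_itv/=; case: ifP => // _; rewrite mul0r.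
Qed.

Lemma continuous_scale c : continuous (fun t : R => - (c * t)).
Proof. by move=> t; apply: cvgN; apply: mulrl_continuous. Qed.

Lemma within_continuousM (A : set R) f g : {within A, continuous f} ->
  continuous g -> {within A, continuous (fun t => f t * g t)}.
Proof.
move=> cf cg t; apply: (@continuousM _ (subspace A)); first exact: cf.
exact: continuous_subspaceT.
Qed.

Lemma within_continuous_cos_sin f w : {within I, continuous f} ->
  {within I, continuous (fun t => f t * cos (- (w * t)))} /\
  {within I, continuous (fun t => f t * sin (- (w * t)))}.
Proof.
move=> cf; split; apply: within_continuousM => // t; apply: continuous_comp.
- exact: continuous_scale.
- exact: continuous_cos.
- exact: continuous_scale.
- exact: continuous_sin.
Qed.

Lemma integrable_cos_sin f w : {within I, continuous f} ->
  mu.-integrable I (EFin \o (fun t => f t * cos (- (w * t)))) /\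
  mu.-integrable I (EFin \o (fun t => f t * sin (- (w * t)))).
Proof.
move=> /(within_continuous_cos_sin w)[cc cs].
by split; exact: integrable_within_itv.
Qed.

Lemma unit_fourier_eq f g w : {in I, f =1 g} ->
  unit_fourier f w = unit_fourier g w.
Proof.
by move=> fg; rewrite !unit_fourierE; congr (_ +i* _); apply: eq_Rintegral => t tI;
  rewrite fg.
Qed.

Lemma integrable_scaler c f :
  mu.-integrable I (EFin \o f) -> mu.-integrable I (EFin \o (fun t => c * f t)).
Proof.
move=> fI; have := @integrableZl _ _ _ mu I _ c _ fI.
by apply; exact: measurable_itv.
Qed.

Lemma unit_fourier_linear c f g w :
  {within I, continuous f} -> {within I, continuous g} ->
  unit_fourier (fun t => c * f t + g t) w =
  c%:C * unit_fourier f w + unit_fourier g w.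
Proof.
move=> /(integrable_cos_sin w)[fc fs] /(integrable_cos_sin w)[gc gs].
rewrite !unit_fourierE; simpc; congr (_ +i* _).
- rewrite -RintegralZl// -RintegralD//; last exact: integrable_scaler.
  by apply: eq_Rintegral => t _; rewrite mulrDl mulrA.
- rewrite -RintegralZl// -RintegralD//; last exact: integrable_scaler.
  by apply: eq_Rintegral => t _; rewrite mulrDl mulrA.
Qed.

(** Complex homogeneity of [cintegral], in the case of a unimodular factor. *)
Lemma cintegral_phase f a w : {within I, continuous f} ->
  cintegral I (fun t => expi a * ((f t)%:C * expi (- (w * t)))) =
  expi a * unit_fourier f w.
Proof.
move=> /(integrable_cos_sin w)[fc fs].
rewrite unit_fourierE; rewrite [expi a]/expi /cintegral; simpc; congr (_ +i* _).
- rewrite -!RintegralZl// -RintegralB//; try exact: integrable_scaler.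
  by apply: eq_Rintegral => t _; rewrite mulC_expi.
- rewrite -!RintegralZl// -RintegralD//; try exact: integrable_scaler.
  by apply: eq_Rintegral => t _; rewrite mulC_expi.
Qed.

Lemma sum_complex (J : finType) (u v : J -> R) :
  \sum_j (u j +i* v j) = (\sum_j u j) +i* (\sum_j v j).
Proof.
by elim/big_rec3 : _ => // j x y _ _ ->; simpc.
Qed.

Lemma continuous_base_map (N : nat) (k : 'I_N) : continuous (@base_map R N k).
Proof.
by move=> t; apply: cvgMl; apply: cvgD; [exact: cvg_id | exact: cvg_cst].
Qed.

Lemma base_map_unit (N : nat) (k : 'I_N) t : I t -> I (base_map k t).
Proof.
have N0 : (0 < N)%N by case: N k => [[]|].
rewrite /= !in_itv/= => /andP[t0 t1]; rewrite divr_ge0 ?addr_ge0//=.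
rewrite ler_pdivrMr ?ltr0n// mul1r.
by apply: le_trans (lerD t1 (lexx _)) _; rewrite addrC natr1 ler_nat.
Qed.

(** On the k-th piece the exponential factors as
    e^{-iw(t+k)/N} = e^{-iwk/N} e^{-i(w/N)t}, so that the piece contributes a
    Fourier integral at the frequency w/N. *)
Lemma unit_fourier_split (N : nat) f w : (0 < N)%N ->
    {within I, continuous f} ->
  unit_fourier f w = (N%:R^-1)%:C *
    \sum_(k < N) expi (- (w * (k%:R / N%:R))) *
      unit_fourier (fun t => f (base_map k t)) (w / N%:R).
Proof.
move=> N0 cf.
have cfk k : {within I, continuous (fun t => f (@base_map R N k t))}.
  apply: (within_continuous_comp (@continuous_base_map N k) _ cf).
  exact: base_map_unit.
under eq_bigr do rewrite -cintegral_phase//.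
rewrite sum_complex; simpc.
have [fc fs] := within_continuous_cos_sin w cf.
have phase (k : 'I_N) t : expi (- (w * (k%:R / N%:R))) *
    ((f (base_map k t))%:C * expi (- (w / N%:R * t))) =
    (f (base_map k t))%:C * expi (- (w * base_map k t)).
  rewrite mulrCA -expiD; congr (_ * expi _).
  by rewrite -opprD /base_map mulrDl mulrDr addrC [w / _ * _]mulrAC -[w * t / _]mulrA.
rewrite unit_fourierE !(Rintegral_unit_split N0)//.
congr (_ * _ +i* _); [|congr (_ * _)]; apply: eq_bigr => k _;
  by apply: eq_Rintegral => t _; rewrite phase mulC_expi.
Qed.

Lemma norm_complex_le a b : `|a +i* b| <= (`|a| + `|b|)%:C.
Proof.
rewrite normc_def lecR/= -(ger0_norm (addr_ge0 (normr_ge0 a) (normr_ge0 b))).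
rewrite -sqrtr_sqr ler_wsqrtr// sqrrD !real_normK ?num_real//.
by rewrite [leRHS]addrAC lerDl mulrn_wge0// mulr_ge0.
Qed.

(** The bound is uniform in the frequency, as the exponential has modulus 1. *)
Lemma norm_unit_fourier_bounded f : {within I, continuous f} ->
  exists M, forall w, `|unit_fourier f w| <= M%:C.
Proof.
move=> cf.
have [M [_ /(_ (M + 1))]] : bounded_set (f @` I) :=
  compact_bounded (continuous_compact cf (@segment_compact R 0 1)).
rewrite ltrDl ltr01 => /(_ isT) fM.
have fM' t : I t -> `|f t| <= M + 1 by move=> It; apply: fM; exists t.
have bound (h : R -> R) : (forall t, `|h t| <= 1) ->
    mu.-integrable I (EFin \o (fun t => f t * h t)) ->
    `|\int[mu]_(t in I) (f t * h t)| <= M + 1.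
  move=> h1 ih; apply: le_trans (le_normr_Rintegral _ ih) _ => //.
  have -> : M + 1 = \int[mu]_(t in I) (cst (M + 1) t).
    rewrite Rintegral_cst//.
    have /= -> := @lebesgue_measure_itv R `[0, 1].
    by rewrite lte_fin ltr01 oppr0 adde0 mulr1.
  apply: le_Rintegral => //.
  - exact: integrable_norm.
  - by apply: integrable_within_itv; apply: continuous_subspaceT => ?; exact: cvg_cst.
  - move=> t It; rewrite normrM -[leRHS]mulr1 ler_pM//; exact: fM'.
(* One copy of the bound for the real part, one for the imaginary part. *)
exists (M + 1 + (M + 1)) => w.
have [fc fs] := integrable_cos_sin w cf.
rewrite unit_fourierE.
apply: le_trans (norm_complex_le _ _) _; rewrite lecR lerD// bound//.
- by move=> t; rewrite ler_norml cos_geN1 cos_le1.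
- by move=> t; rewrite ler_norml sin_geN1 sin_le1.
Qed.
End ComplexIntegral.

(** * Recursion for the terms of the series *)

Section Words.
Local Open Scope complex_scope.
Context {R : realType} {N : nat}.
Implicit Types (gamma : 'I_N -> R) (q : 'I_N -> R -> R) (w : R) (k : 'I_N).

Definition word_cons j k (v : {ffun 'I_j -> 'I_N}) : {ffun 'I_j.+1 -> 'I_N} :=
  [ffun l => oapp v k (unlift ord0 l)].

Lemma word_cons0 j k (v : {ffun 'I_j -> 'I_N}) : word_cons k v ord0 = k.
Proof. by rewrite ffunE unlift_none. Qed.

Lemma word_consS j k (v : {ffun 'I_j -> 'I_N}) l :
  word_cons k v (lift ord0 l) = v l.
Proof. by rewrite ffunE liftK. Qed.

(** Requires a nonempty tail: the last letter of a one-letter word is its head. *)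
Lemma word_cons_max j k (v : {ffun 'I_j.+1 -> 'I_N}) :
  word_cons k v ord_max = v ord_max.
Proof.
by rewrite -(word_consS k v); congr (word_cons k v _); exact: val_inj.
Qed.

Lemma big_word_cons (V : nmodType) j (F : {ffun 'I_j.+1 -> 'I_N} -> V) :
  \sum_v F v = \sum_(k < N) \sum_(v : {ffun 'I_j -> 'I_N}) F (word_cons k v).
Proof.
rewrite pair_bigA/=.
rewrite (reindex (fun p : 'I_N * {ffun 'I_j -> 'I_N} => word_cons p.1 p.2))//=.
exists (fun v => (v ord0, [ffun l => v (lift ord0 l)])) => [[k v] _|v _] /=.
  by rewrite word_cons0; congr pair; apply/ffunP => l; rewrite ffunE word_consS.
apply/ffunP => l; case: (unliftP ord0 l) => [i|] ->.
  by rewrite word_consS ffunE.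
by rewrite word_cons0.
Qed.

Lemma base_point_cons j k (v : {ffun 'I_j -> 'I_N}) :
  base_point (word_cons k v) = (k%:R / N%:R + base_point v / N%:R) :> R.
Proof.
rewrite /base_point big_ord_recl word_cons0 expr1 mulr_suml; congr (_ + _).
apply: eq_bigr => l _; rewrite word_consS -mulrA -invfM; congr (_ / _).
by rewrite [RHS]mulrC -exprS.
Qed.

Lemma prod_word_cons gamma j k (v : {ffun 'I_j.+1 -> 'I_N}) :
  \prod_(l < j.+2 | (l < j.+1)%N) gamma (word_cons k v l) =
  gamma k * \prod_(l < j.+1 | (l < j)%N) gamma (v l).
Proof.
rewrite big_mkcond big_ord_recl/= word_cons0; congr (_ * _).
by rewrite [RHS]big_mkcond; apply: eq_bigr => l _; rewrite word_consS.
Qed.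

Lemma fif_fourier_termE gamma q w j : fif_fourier_term gamma q w j =
  ((N%:R ^+ j.+1)^-1)%:C *
  \sum_(v : {ffun 'I_j.+1 -> 'I_N})
    (\prod_(l < j.+1 | (l < j)%N) gamma (v l))%:C * expi (- (w * base_point v)) *
    unit_fourier (q (v ord_max)) (w / N%:R ^+ j.+1).
Proof.
congr (_ * _); apply: eq_bigr => v _; congr (_ * cintegral _ _).
by apply/funext => t; rewrite mulrAC.
Qed.

Lemma fif_fourier_term0 gamma q w : fif_fourier_term gamma q w 0 =
  (N%:R^-1)%:C * \sum_(k < N) expi (- (w * (k%:R / N%:R))) *
    unit_fourier (q k) (w / N%:R).
Proof.
rewrite fif_fourier_termE expr1 big_word_cons; congr (_ * _).
apply: eq_bigr => k _.
have uniq0 (v : {ffun 'I_0 -> 'I_N}) : v = finfun (fun=> k).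
  by apply/ffunP => -[].
rewrite (big_pred1 (finfun (fun=> k))) => [|v]; last exact/esym/eqP/uniq0.
rewrite big_pred0// mul1r base_point_cons /base_point big_ord0 mul0r addr0.
have -> : (ord_max : 'I_1) = ord0 by exact: val_inj.
by rewrite word_cons0.
Qed.

(** A first letter k adds k/N to the base point and divides the rest of it by N,
    which amounts to the phase e^{-iwk/N} and the frequency w/N. *)
Lemma fif_fourier_termS gamma q w j : fif_fourier_term gamma q w j.+1 =
  (N%:R^-1)%:C * \sum_(k < N) expi (- (w * (k%:R / N%:R))) *
    ((gamma k)%:C * fif_fourier_term gamma q (w / N%:R) j).
Proof.
rewrite !fif_fourier_termE big_word_cons exprS invfM rmorphM -[LHS]mulrA.
congr (_ * _); rewrite mulr_sumr; apply: eq_bigr => k _.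
rewrite !mulr_sumr; apply: eq_bigr => v _.
rewrite prod_word_cons word_cons_max base_point_cons.
have -> : - (w * (k%:R / N%:R + base_point v / N%:R)) =
    - (w * (k%:R / N%:R)) + - (w / N%:R * base_point v).
  by rewrite -opprD mulrDr [w / _ * _]mulrAC -[w * _ / _]mulrA.
rewrite expiD rmorphM.
rewrite /= [w * (_^-1 / _)]mulrA.
have shuffle (n g p a b u : R[i]) :
  n * (g * p * (a * b) * u) = a * (g * (n * (p * b * u))) by ring.
exact: shuffle.
Qed.

(** This is the functional equation of [unit_fourier f] with the partial sums
    in place of [unit_fourier f], which makes the terms in q cancel between
    the two. *)
Lemma fif_fourier_partial_sumS gamma q w n :
  \sum_(j < n.+1) fif_fourier_term gamma q w j =
  (N%:R^-1)%:C * \sum_(k < N) expi (- (w * (k%:R / N%:R))) *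
    ((gamma k)%:C * \sum_(j < n) fif_fourier_term gamma q (w / N%:R) j +
     unit_fourier (q k) (w / N%:R)).
Proof.
rewrite big_ord_recl fif_fourier_term0.
under [X in _ + X = _]eq_bigr do rewrite lift0 fif_fourier_termS.
rewrite -mulr_sumr exchange_big -mulrDr -big_split/=; congr (_ * _).
apply: eq_bigr => k _.
by rewrite -mulr_sumr -mulr_sumr -mulrDr addrC.
Qed.
End Words.

(** * Geometric decay of the remainder *)

Section Main.
Local Open Scope complex_scope.
Context {R : realType} {N : nat}.
Implicit Types (gamma : 'I_N -> R) (q : 'I_N -> R -> R) (w : R) (k : 'I_N).
Local Notation I := (`[0, 1]%classic : set R).

(** Invariance puts the image of (t, f t) under the k-th map on the graph again;
    its abscissa determines its ordinate. *)
Lemma ifs_invariant_graph_eq gamma q (f : R -> R) :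
    ifs_invariant strip (ifs_map gamma q) [set (t, f t) | t in I] ->
  forall k t, I t -> f (base_map k t) = gamma k * f t + q k t.
Proof.
case=> _ _ _ graphE k t It.
have : [set (t, f t) | t in I] (ifs_map gamma q k (t, f t)).
  by rewrite graphE; exists k => //; exists (t, f t) => //; exists t.
by case=> s _ [<- ->].
Qed.

Lemma unit_fourier_fif gamma q f w : (0 < N)%N ->
    {within I, continuous f} -> (forall k, {within I, continuous (q k)}) ->
    (forall k t, I t -> f (base_map k t) = gamma k * f t + q k t) ->
  unit_fourier f w = (N%:R^-1)%:C *
    \sum_(k < N) expi (- (w * (k%:R / N%:R))) *
      ((gamma k)%:C * unit_fourier f (w / N%:R) + unit_fourier (q k) (w / N%:R)).
Proof.
move=> N0 cf cq fE; rewrite (unit_fourier_split w N0 cf).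
congr (_ * _); apply: eq_bigr => k _; congr (_ * _).
rewrite -unit_fourier_linear//; apply: unit_fourier_eq => t /set_mem It.
exact: fE.
Qed.

(** The remainders satisfy the functional equation of U f without the terms
    in q, and averaging the N terms over k costs nothing beyond the factor g. *)
Lemma fif_fourier_remainder gamma q f (g M : R) : (0 < N)%N -> 0 <= g ->
    (forall k, `|gamma k| <= g) ->
    {within I, continuous f} -> (forall k, {within I, continuous (q k)}) ->
    (forall k t, I t -> f (base_map k t) = gamma k * f t + q k t) ->
    (forall w, `|unit_fourier f w| <= M%:C) ->
  forall n w, `|unit_fourier f w - \sum_(j < n) fif_fourier_term gamma q w j|
    <= (g ^+ n * M)%:C.
Proof.
move=> N0 g0 gammag cf cq fE fM; elim=> [|n IHn] w.
  by rewrite big_ord0 subr0 mul1r.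
have -> : unit_fourier f w - \sum_(j < n.+1) fif_fourier_term gamma q w j =
    (N%:R^-1)%:C * \sum_(k < N) expi (- (w * (k%:R / N%:R))) *
      ((gamma k)%:C * (unit_fourier f (w / N%:R) -
         \sum_(j < n) fif_fourier_term gamma q (w / N%:R) j)).
  rewrite (unit_fourier_fif w N0 cf cq fE) fif_fourier_partial_sumS -mulrBr -sumrB.
  congr (_ * _); apply: eq_bigr => k _.
  by rewrite -mulrBr opprD addrACA subrr addr0 -mulrBr.
rewrite normrM.
have -> : (g ^+ n.+1 * M)%:C = `|(N%:R^-1)%:C| * \sum_(k < N) (g * (g ^+ n * M))%:C.
  rewrite sumr_const card_ord exprS -mulrA ger0_norm ?ler0c ?invr_ge0//.
  rewrite -rmorphMn -rmorphM; congr _%:C.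
  by rewrite -[X in _ = _ * X]mulr_natl mulKf// pnatr_eq0 -lt0n.
apply: ler_wpM2l => //; apply: le_trans (ler_norm_sum _ _ _) _.
apply: ler_sum => k _; rewrite !normrM norm_expi mul1r rmorphM ler_pM//.
by rewrite normc_def/= expr0n addr0 sqrtr_sqr lecR.
Qed.
End Main.

Theorem theorem3p1 (R : realType) (N : nat) (x y : 'I_N.+1 -> R)
    (gamma : 'I_N -> R) (q : 'I_N -> R -> R) (f : R -> R)
    (x_nodes : equispaced_nodes x)
    (y_first : y ord0 = 0) (y_last : y ord_max = 0)
    (f_fif : is_fif x y gamma q f) (w : R) :
  series (fif_fourier_term gamma q w : nat -> R[i]^o) @ \oo
    --> (fourier (extend0 f) w : R[i]^o).
Proof.
case: f_fif => -[gamma1 cq _ _] cf [/ifs_invariant_graph_eq fE _].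
(* For N = 0 the first and the last node coincide, so 0 = 1. *)
have N0 : (0 < N)%N.
  case: N x {y gamma q f y_first y_last gamma1 cq cf fE} x_nodes => // x [x0 x1 _ _].
  have max0 : ord_max = ord0 :> 'I_1 by exact: val_inj.
  by move: x1; rewrite max0 x0 => /esym/eqP; rewrite oner_eq0.
pose g := \big[Num.max/0]_(k < N) `|gamma k|.
have g0 : 0 <= g by exact: bigmax_ge_id.
have gammag k : `|gamma k| <= g by exact: le_bigmax.
have g1 : g < 1 by apply: bigmax_lt.
have [M fM] := norm_unit_fourier_bounded cf.
have rem := fif_fourier_remainder N0 g0 gammag cf cq fE fM.
rewrite fourier_extend0; apply/cvgrPdist_le => e e0.
have [e' eE] : exists e' : R, e = e'%:C%C.
  by move: e0; rewrite ltcE/= => /andP[/eqP ei _]; exists (complex.Re e);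
    case: e ei => a b /= ->.
have e'0 : 0 < e' by move: e0; rewrite eE ltcR.
have /cvgrPdist_le/(_ _ e'0) : g ^+ n * M @[n --> \oo] --> (0 : R).
  rewrite -[X in _ --> X](mul0r M); apply: cvgMl; apply: cvg_expr.
  by rewrite ger0_norm.
apply: filterS => n; rewrite sub0r normrN => gnM.
rewrite /series/= big_mkord; apply: le_trans (rem n w) _.
by rewrite eE lecR; exact: le_trans (ler_norm _) gnM.
Qed.
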